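(* Let $V=\mathbb{F}^d$ ($d\ge2$), the type $\mathbf{X}$ and the group $G$ be as in the context. Let $e\ge e'$ be positive integers with $e+e'\le d$, let $\mathcal{C}$ be a $G$-conjugacy class of $e$-stingray elements and $\mathcal{C}'$ a $G$-conjugacy class of $e'$-stingray elements. For $g\in G$ write $U_g=\mathrm{im}(g-1)$, and let $\mathcal{U}=\{U_g\mid g\in\mathcal{C}\}$ and $\mathcal{U}'=\{U_{g'}\mid g'\in\mathcal{C}'\}$. Then $$\frac{|\{(g,g')\in\mathcal{C}\times\mathcal{C}' \mid (g,g')\text{ is an }(e,e')\text{-stingray duo}\}|}{|\mathcal{C}\times\mathcal{C}'|}=\rho(\mathbf{X},V,\mathcal{U},\mathcal{U}').$$
   Context: Let $q$ be a prime power and $V=\mathbb{F}^d$ a vector space over a finite field $\mathbb{F}$ with a non-degenerate form of type $\mathbf{X}$, where: $\mathbf{X}=\mathbf{U}$ means $|\mathbb{F}|=q^2$ and $V$ carries a non-degenerate hermitian form; $\mathbf{X}=\mathbf{Sp}$ means $|\mathbb{F}|=q$ and $V$ carries a non-degenerate alternating form; $\mathbf{X}=\mathbf{O}^\varepsilon$ means $|\mathbb{F}|=q\ge3$ and $V$ carries a quadratic form of type $\varepsilon$ whose polar form is non-degenerate, where either $d$ is even and $\varepsilon\in\{-,+\}$, or $d$ and $q$ are odd and $\varepsilon=\circ$. Non-degeneracy of subspaces is with respect to the hermitian, alternating or polar form. $G$ is a group of isometries of $V$ with $\mathrm{SU}_d(q)\trianglelefteq G\le\mathrm{GU}_d(q)$,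 or $G=\mathrm{Sp}_d(q)$, or $\Omega_d^\varepsilon(q)\trianglelefteq G\le \mathrm{GO}_d^\varepsilon(q)$ (full isometry group), respectively. An element $g\in G$ is an $e$-stingray element if $\dim(U_g)=e$, where $U_g=\mathrm{im}(g-1)$, and $g$ acts irreducibly on $U_g$. For sets $\mathcal{U},\mathcal{U}'$ of subspaces, a pair $(U,U')\in\mathcal{U}\times\mathcal{U}'$ is an $\mathbf{X}$-duo if $U\cap U'=0$ and $U\oplus U'$ is non-degenerate, and $\rho(\mathbf{X},V,\mathcal{U},\mathcal{U}')$ is the number of $\mathbf{X}$-duos in $\mathcal{U}\times\mathcal{U}'$ divided by $|\mathcal{U}|\cdot|\mathcal{U}'|$. A pair $(g,g')$ consisting of an $e$-stingray element $g$ and an $e'$-stingray element $g'$ with $e\ge e'$ is an $(e,e')$-stingray duo if $(U_g,U_{g'})$ is an $\mathbf{X}$-duo, that is, $U_g\cap U_{g'}=0$ and $U_g\oplus U_{g'}$ is non-degenerate. *)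

(* Defs.v *)
From mathcomp Require Import all_boot all_fingroup all_algebra.

Set Implicit Arguments.
Unset Strict Implicit.
Unset Printing Implicit Defensive.

Import GroupScope GRing.Theory.
Local Open Scope ring_scope.

Definition prime_power (q : nat) : Prop :=
  exists p k : nat, [/\ prime p, (0 < k)%N & q = (p ^ k)%N].

Inductive orthogonal_sign := OMinus | OPlus | OCirc.

(* V is the space 'rV[F]_n.+1, of dimension d = n.+1, on which matrices act
   on the right. The type X and the form are carried together; no property of
   the form is built in here, see classical_space. *)
Inductive form_data (F : finFieldType) (n : nat) :=
| Unitary of 'rV[F]_n.+1 -> 'rV[F]_n.+1 -> F
| Symplectic of 'rV[F]_n.+1 -> 'rV[F]_n.+1 -> F
| Orthogonal of orthogonal_sign & ('rV[F]_n.+1 -> F).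

Section Classical.

Variables (F : finFieldType) (n : nat).
Local Notation V := 'rV[F]_n.+1.
(* Subspaces of V are row spaces of square matrices (scope %MS); in sets and
   in cardinalities they are represented by the canonical matrix <<A>>%MS. *)
Local Notation subspace := 'M[F]_n.+1.
Local Notation GL := {'GL_n.+1[F]}.
Implicit Types (B : V -> V -> F) (Q : V -> F) (U W : subspace) (g : GL).

Definition polar Q : V -> V -> F := fun u v => Q (u + v) - Q u - Q v.

Definition hermitian_form (q : nat) B : Prop :=
  (forall v, scalar (B^~ v)) /\ (forall u v, B u v = B v u ^+ q).

Definition alternating_form B : Prop :=
  [/\ forall v, scalar (B^~ v), forall u, scalar (B u) & forall v, B v v = 0].

Definition quadratic_form Q : Prop :=
  [/\ forall a v, Q (a *: v) = a ^+ 2 * Q v,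
      forall v, scalar ((polar Q)^~ v) & forall u, scalar (polar Q u)].

Definition nondegenerate_on B W : bool :=
  [forall u : V,
    (u <= W)%MS && [forall w : V, (w <= W)%MS ==> (B u w == 0)] ==> (u == 0)].

Definition totally_singular Q W : bool :=
  [forall w : V, (w <= W)%MS ==> (Q w == 0)].

Definition witt_index Q : nat :=
  \max_(W : subspace | totally_singular Q W) \rank W.

(* A form with non-degenerate polar form in even dimension d has Witt index
   d/2 (type +) or d/2 - 1 (type -). *)
Definition has_sign (q : nat) (eps : orthogonal_sign) Q : Prop :=
  match eps with
  | OPlus => ~~ odd n.+1 /\ witt_index Q = n.+1./2
  | OMinus => ~~ odd n.+1 /\ (witt_index Q).+1 = n.+1./2
  | OCirc => odd n.+1 /\ odd q
  end.

Definition assoc_form (X : form_data F n) : V -> V -> F :=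
  match X with
  | Unitary B | Symplectic B => B
  | Orthogonal _ Q => polar Q
  end.

Definition classical_space (q : nat) (X : form_data F n) : Prop :=
  nondegenerate_on (assoc_form X) 1%:M /\
  match X with
  | Unitary B => #|F| = (q ^ 2)%N /\ hermitian_form q B
  | Symplectic B => #|F| = q /\ alternating_form B
  | Orthogonal eps Q =>
      [/\ #|F| = q, (3 <= q)%N, quadratic_form Q & has_sign q eps Q]
  end.

Definition form_isometries B : {set GL} :=
  [set g : GL | [forall u : V, forall v : V,
     B (u *m GLval g) (v *m GLval g) == B u v]].

Definition SU B : {set GL} :=
  [set g in form_isometries B | \det (GLval g) == 1].

Definition GO Q : {set GL} :=
  [set g : GL | [forall v : V, Q (v *m GLval g) == Q v]].

(* Omega is the commutator subgroup of the full isometry group. For d >= 2 it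
   agrees with the definition by spinor norm and determinant (q odd) or by the
   Dickson invariant (q even), except for O_4^+(2), which 3 <= q excludes. *)
Definition Omega Q : {set GL} := [~: GO Q, GO Q]%g.

Definition classical_group (X : form_data F n) (G : {group GL}) : Prop :=
  match X with
  | Unitary B => (SU B <| G)%g /\ G \subset form_isometries B
  | Symplectic B => G :=: form_isometries B
  | Orthogonal _ Q => (Omega Q <| G)%g /\ G \subset GO Q
  end.

Definition im1 g : subspace := <<GLval g - 1%:M>>%MS.

Definition irreducible_on g U : bool :=
  (U != 0) && [forall W : subspace,
    (W <= U)%MS && stablemx W (GLval g) ==> (W == 0) || (U <= W)%MS].

Definition stingray (e : nat) g : bool :=
  (\rank (im1 g) == e) && irreducible_on g (im1 g).

Definition is_duo (X : form_data F n) (p : subspace * subspace) : bool :=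
  ((p.1 :&: p.2)%MS == 0) && nondegenerate_on (assoc_form X) (p.1 + p.2)%MS.

Definition stingray_duo (X : form_data F n) (e e' : nat) (p : GL * GL) : bool :=
  [&& (e' <= e)%N, stingray e p.1, stingray e' p.2
    & is_duo X (im1 p.1, im1 p.2)].

Definition rho (X : form_data F n) (A A' : {set subspace}) : rat :=
  #|[set p in setX A A' | is_duo X p]|%:R / (#|A| * #|A'|)%:R.

End Classical.

(* Main.v *)
(* Conjugation by a in G sends the elements g of C with im(g - 1) = U onto those
   with im(g - 1) = U a, and G permutes the image spaces of C transitively. So
   the map g |-> im(g - 1) has fibres of constant size on C and on C', and being
   a stingray duo depends only on the two image spaces: both counts on the left
   are the counts for the pairs of spaces, multiplied by the same factor. *)
Require Import Defs.
From mathcomp Require Import all_boot all_fingroup all_algebra.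

Set Implicit Arguments.
Unset Strict Implicit.
Unset Printing Implicit Defensive.

Import GroupScope GRing.Theory.
Local Open Scope ring_scope.

(** The preimage of [B] splits into the fibres over the points of [B]. Each point is some [f x] with
    [x] in [A], so every such fibre has exactly [k] elements. *)
Lemma card_preim_uniform (aT rT : finType) (f : aT -> rT) (A : {set aT})
    (B : {set rT}) (k : nat) :
    B \subset f @: A ->
    {in A, forall x, #|[set z in A | f z == f x]| = k} ->
  #|[set x in A | f x \in B]| = (k * #|B|)%N.
Proof.
move=> /subsetP sBA fibk; rewrite -sum1_card.
rewrite (partition_big f (mem B)) /=; last by move=> x; rewrite inE => /andP[].
rewrite mulnC -sum_nat_const; apply: eq_bigr => y By.
have /imsetP[x Ax Dy] := sBA y By.
rewrite -(fibk x Ax) -sum1_card; apply: eq_bigl => z.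
by rewrite !inE Dy; case: eqP => [->|]; rewrite ?andbT ?andbF // -Dy By andbT.
Qed.

Section ImageSpaces.

Variables (F : finFieldType) (n : nat).
Implicit Types (g h a : {'GL_n.+1[F]}) (G : {group {'GL_n.+1[F]}}).

(** Since [g ^ a - 1] equals [a^-1 (g - 1) a], and the invertible left factor leaves the row space
    unchanged, only right multiplication by [a] remains. *)
Lemma im1J g a : im1 (g ^ a)%g = <<im1 g *m GLval a>>%MS.
Proof.
have aU : GLval a \in unitmx := valP a.
have iU : row_full (invmx (GLval a)) by rewrite row_full_unit unitmx_inv.
rewrite /im1; apply/genmxP/eqmxP.
have -> : GLval (g ^ a)%g - 1%:M
            = invmx (GLval a) *m ((GLval g - 1%:M) *m GLval a).
  by rewrite mulmxBl mul1mx mulmxBr mulVmx.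
apply: eqmx_trans (eqmxMfull _ iU) _.
exact/eqmx_sym/eqmxMr/genmxE.
Qed.

Lemma im1J_eq g h a : (im1 (g ^ a)%g == im1 (h ^ a)%g) = (im1 g == im1 h).
Proof.
apply/eqP/eqP=> [E | E]; last by rewrite !im1J E.
by rewrite -(conjgK a g) -(conjgK a h) im1J E -im1J.
Qed.

Lemma im1_fiber_uniform G (C : {set {'GL_n.+1[F]}}) :
    C \in classes G ->
  {in C &, forall g h, #|[set z in C | im1 z == im1 g]|
                         = #|[set z in C | im1 z == im1 h]|}.
Proof.
case/imsetP=> x Gx -> g h /class_eqP Exg; rewrite -Exg => /imsetP[a Ga ->].
rewrite -(card_imset _ (conjg_inj a)); apply: eq_card => z.
(* Writing [z] as a conjugate by [a] turns both memberships into conditions on [z ^ a^-1]; they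
   agree because [a] normalises the class of [g]. *)
rewrite -[z](conjgKV a) (mem_imset _ _ (conjg_inj a)) !inE im1J_eq.
by rewrite [in RHS]memJ_norm ?(subsetP (class_norm g G)).
Qed.

End ImageSpaces.

Theorem lemma3p12 (q : nat) (F : finFieldType) (n : nat) (X : form_data F n)
    (G : {group {'GL_n.+1[F]}}) (e e' : nat) (C C' : {set {'GL_n.+1[F]}})
    (hq : prime_power q) (hd : (2 <= n.+1)%N)
    (hX : classical_space q X) (hG : classical_group X G)
    (he' : (0 < e')%N) (hee' : (e' <= e)%N) (hed : (e + e' <= n.+1)%N)
    (hC : C \in classes G) (hCe : {in C, forall g, stingray e g})
    (hC' : C' \in classes G) (hCe' : {in C', forall g, stingray e' g}) :
  #|[set p in setX C C' | stingray_duo X e e' p]|%:R / #|setX C C'|%:R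
    = rho X [set im1 g | g in C] [set im1 g | g in C'] :> rat.
Proof.
have [g gC] : exists g, g \in C.
  by case/imsetP: hC => g _ ->; exists g; apply: class_refl.
have [g' gC'] : exists g', g' \in C'.
  by case/imsetP: hC' => g' _ ->; exists g'; apply: class_refl.
pose im2 (p : {'GL_n.+1[F]} * {'GL_n.+1[F]}) := (im1 p.1, im1 p.2).
(* A reference fibre of the map on pairs: its size is the common factor in both counts. *)
pose fib := [set z in setX C C' | im2 z == im2 (g, g')].
have fibE : {in setX C C', forall p,
    #|[set z in setX C C' | im2 z == im2 p]| = #|fib|}.
  have fibX p : [set z in setX C C' | im2 z == im2 p]
      = setX [set z in C | im1 z == im1 p.1] [set z in C' | im1 z == im1 p.2].
    by apply/setP=> -[z z']; rewrite !inE xpair_eqE /= andbACA.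
  move=> [h h'] /setXP[hhC hhC']; rewrite /fib !fibX !cardsX /=.
  by congr (_ * _)%N; apply: im1_fiber_uniform; eassumption.
set U := imset _ (mem C); set U' := imset _ (mem C').
have im2X : im2 @: setX C C' = setX U U'.
  apply/setP=> -[W W']; apply/imsetP/setXP => /=.
    by case=> -[h h'] /setXP[hhC hhC'] [-> ->]; split; apply: imset_f.
  case=> /imsetP[h hhC ->] /imsetP[h' hhC' ->].
  by exists (h, h'); rewrite // inE hhC.
have fib_gt0 : (#|fib| != 0)%N.
  by rewrite -lt0n; apply/card_gt0P; exists (g, g'); rewrite !inE gC gC' eqxx.
have cardD : #|[set p in setX C C' | stingray_duo X e e' p]|
    = (#|fib| * #|[set p in setX U U' | is_duo X p]|)%N.
  rewrite -(card_preim_uniform _ fibE); last first.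
    by rewrite im2X; apply/subsetP=> p; rewrite inE => /andP[].
  apply: eq_card => -[h h']; rewrite !inE /=.
  have [/andP[hhC hhC'] | //] := boolP ((h \in C) && (h' \in C')).
  (* On [C] and [C'] the stingray conditions hold throughout, so only the condition [is_duo] on the
     two image spaces is left. *)
  by rewrite /stingray_duo /= hee' hCe // hCe' // !imset_f.
have cardX : #|setX C C'| = (#|fib| * #|setX U U'|)%N.
  (* The same count, now with the whole image of [im2] as target set. *)
  rewrite -(card_preim_uniform _ fibE) ?im2X //.
  apply: eq_card => p; rewrite inE -im2X.
  by case: (boolP (p \in _)) => // Cp; rewrite imset_f.
rewrite cardD cardX /rho cardsX !(natrM _ #|fib|) -mulf_div divff ?mul1r //.
by rewrite Num.Theory.pnatr_eq0.
Qed.
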